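(* Let $R$ be a commutative ring with identity, let $n\geq 2$, and let $f,g\in R[X]$ be monic polynomials of degree $n$ with companion matrices $C,D\in M_n(R)$, respectively. Suppose the resultant $R(f,g)$ is a unit of $R$. Let $P_1,\dots,P_{n-1}\in R[X,Y]$ be the explicit polynomials defined in the context or, more generally, be arbitrary elements of $R[X,Y]$ satisfying $$D^jC=P_j(C,D),\quad j=1,\dots,n-1.$$ Then, via $X\mapsto C$, $Y\mapsto D$, the matrix algebra $M_n(R)$ has presentation $$\langle X,Y\,|\, f(X)=0,\ g(Y)=0,\ Y^jX=P_j(X,Y),\ j=1,\dots,n-1\rangle.$$ In the particular case when $g-f$ is a unit in $R$ (i.e. $g-f$ is a constant polynomial equal to a unit of $R$), the matrix algebra $M_n(R)$ has presentation $$\langle X,Y\,|\, f(X)=0,\ g(Y)=0,\ Y^jX+X^jY=X^{j+1}+Y^{j+1},\ j=1,\dots,n-1\rangle.$$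
   Context: The companion matrix of a monic polynomial $f=f_0+f_1X+\cdots+f_{n-1}X^{n-1}+X^n\in R[X]$ is the matrix in $M_n(R)$ whose $j$-th column is $e_{j+1}$ for $1\leq j\leq n-1$ and whose last column is $(-f_0,-f_1,\dots,-f_{n-1})^t$, where $e_1,\dots,e_n$ is the canonical basis of the column space $R^n$. $R\langle X,Y\rangle$ is the free (noncommutative, unital) $R$-algebra on $X,Y$, and in this setting $R[X,Y]$ denotes the $R$-submodule of $R\langle X,Y\rangle$ spanned by the monomials $X^iY^j$, $i,j\geq 0$ (powers of $X$ to the left of powers of $Y$). For $P\in R[X,Y]$, $P(C,D)$ is the image of $P$ under the $R$-algebra homomorphism $R\langle X,Y\rangle\to M_n(R)$ sending $X\mapsto C$, $Y\mapsto D$. A presentation $\langle X,Y\,|\,\text{relations}\rangle$ means the quotient of $R\langle X,Y\rangle$ by the two-sided ideal generated by the relations. The explicit polynomials $P_j$: let $s=g-f$ (a polynomial of degree less than $n$), let $a_j$ be the $(n,j)$-entry of the matrix $s(D)$, let $p_j(X)=X^j-a_1X^{j-1}-\cdots-a_{j-1}X-a_j$ for $1\leq j\leq n-1$, and set $P_j(X,Y)=p_j(X)(X-Y)+Y^{j+1}$ for $1\leq j\leq n-1$. (These satisfy $D^jC=P_j(C,D)$.) *)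

(* Defs.v *)
From HB Require Import structures.
From mathcomp Require Import all_boot all_order all_algebra.
From mathcomp Require Import generic_quotient ring_quotient.
From mathcomp Require Import boolp.
From mathcomp Require Import finmap.
From mathcomp.multinomials Require Import monalg.

Set Implicit Arguments.
Unset Strict Implicit.
Unset Printing Implicit Defensive.

Import GRing.Theory.

Local Open Scope ring_scope.
Local Open Scope quotient_scope.

(* R<X, Y> is the monoid algebra of the free monoid on 'I_2, whose generators
   0 and 1 stand for X and Y. The library provides its ring and left algebra
   structures; centrality of the scalars is added here. *)
Definition freealg (R : comNzRingType) : Type := {malg R[{fmonom 'I_2}]}.

HB.instance Definition _ (R : comNzRingType) :=
  GRing.Lalgebra.on (freealg R).

Lemma freealg_scalerAr (R : comNzRingType) (k : R) (a b : freealg R) :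
  k *: (a * b) = a * (k *: b).
Proof.
apply/malgP => m; rewrite mcoeffZ (mcoeffMl a b).
have le_kb : (msupp (k *: b) `<=` msupp b)%fset := msuppZ_le _ _.
rewrite (mcoeffMlw m (fsubset_refl (msupp a)) le_kb) mulr_sumr.
apply: eq_bigr => k1 _; rewrite mulr_sumr; apply: eq_bigr => k2 _.
by rewrite mulrnAr (mcoeffZ k b) [k * (_ * _)]mulrCA.
Qed.

HB.instance Definition _ (R : comNzRingType) :=
  GRing.LSemiAlgebra_isSemiAlgebra.Build R (freealg R)
    (@freealg_scalerAr R).

Section FreeAlgebra.
Variable R : comNzRingType.

Definition fgen (i : 'I_2) : freealg R := (<< fmu i >>)%R.
Definition fX : freealg R := fgen 0.
Definition fY : freealg R := fgen 1.

Variables (A : algType R) (x y : A).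

Definition word_eval (m : {fmonom 'I_2}) : A :=
  \prod_(i <- (m : seq 'I_2)) (if i == 0 then x else y).

Definition feval (p : freealg R) : A := mmap (in_alg A) word_eval p.

Lemma word_eval_mmorphism : mmorphism word_eval.
Proof.
by split=> [m1 m2|]; rewrite /word_eval ?fmM ?big_cat ?fm1 ?big_nil.
Qed.

HB.instance Definition _ :=
  isMultiplicative.Build {fmonom 'I_2} A word_eval word_eval_mmorphism.

Lemma feval_zmod_morphism : zmod_morphism feval.
Proof. by move=> p q; rewrite /feval (mmapB p q). Qed.

HB.instance Definition _ :=
  GRing.isZmodMorphism.Build (freealg R) A feval feval_zmod_morphism.

Lemma feval_monoid_morphism : monoid_morphism feval.
Proof.
have H := @commr_mmap_is_multiplicative _ _ _ (in_alg A) word_eval.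
have cH (g : {malg R[{fmonom 'I_2}]}) (m m' : {fmonom 'I_2}) :
    GRing.comm (in_alg A g@_m) (word_eval m').
  by rewrite /GRing.comm /= comm_alg.
by have [] := H cH; split.
Qed.

HB.instance Definition _ :=
  GRing.isMonoidMorphism.Build (freealg R) A feval feval_monoid_morphism.

Lemma feval_scalable : scalable feval.
Proof. by move=> c p; rewrite /feval (mmapZ c p) /= -scalerAl mul1r. Qed.

HB.instance Definition _ :=
  GRing.isScalable.Build R (freealg R) A *:%R feval feval_scalable.

Lemma fevalX : feval fX = x.
Proof.
by rewrite /feval mmapU /= /word_eval fmU big_seq1 eqxx scale1r mul1r.
Qed.

Lemma fevalY : feval fY = y.
Proof. by rewrite /feval mmapU /= /word_eval fmU big_seq1 scale1r mul1r. Qed.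

End FreeAlgebra.

(* Membership in R[X,Y]: the R-span of the X^i Y^j inside R<X,Y>. *)
Definition in_XY (R : comNzRingType) (p : freealg R) : Prop :=
  exists (d : nat) (c : nat -> nat -> R),
    p = \sum_(i < d) \sum_(j < d) c i j *: (fX R ^+ i * fY R ^+ j).

Section Quotient.
Variables (R : comNzRingType) (A : algType R) (S : A -> Prop).

Inductive ideal_gen : A -> Prop :=
| Ideal_gen a of S a : ideal_gen a
| Ideal_zero : ideal_gen 0
| Ideal_add a b of ideal_gen a & ideal_gen b : ideal_gen (a + b)
| Ideal_mull a b of ideal_gen b : ideal_gen (a * b)
| Ideal_mulr a b of ideal_gen a : ideal_gen (a * b).

Definition ideal_pred : {pred A} := fun a => `[< ideal_gen a >].

Lemma ideal_predP a : reflect (ideal_gen a) (a \in ideal_pred).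
Proof. exact: asboolP. Qed.

Lemma ideal_pred_zmod_closed : zmod_closed ideal_pred.
Proof.
split; first by apply/ideal_predP; exact: Ideal_zero.
move=> a b /ideal_predP Ia /ideal_predP Ib; apply/ideal_predP.
by rewrite -mulN1r; apply: Ideal_add => //; exact: Ideal_mull.
Qed.

HB.instance Definition _ :=
  GRing.isZmodClosed.Build A ideal_pred ideal_pred_zmod_closed.

(* The quotient of A by the two-sided ideal generated by S. It may be the zero
   ring, so it only carries the structures pzRingType and lmodType, rather than
   algType. *)
Definition quot_alg : Type := @Quotient.quot A ideal_pred.

HB.instance Definition _ := GRing.Zmodule.on quot_alg.
HB.instance Definition _ := EqQuotient.on quot_alg.

Definition quot_pi (a : A) : quot_alg := \pi_(@Quotient.quot A ideal_pred) a.

Lemma quot_piP a b : quot_pi a = quot_pi b <-> ideal_gen (a - b).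
Proof.
split=> [/eqP|/ideal_predP ab]; first by rewrite -Quotient.idealrBE => /ideal_predP.
by apply/eqP; rewrite -Quotient.idealrBE.
Qed.

Lemma quot_reprK (q : quot_alg) : quot_pi (repr q) = q.
Proof. exact: reprK. Qed.

Lemma quot_pi_zmod_morphism : zmod_morphism quot_pi.
Proof. by move=> a b; apply: (raddfB \pi_(@Quotient.quot A ideal_pred)). Qed.

HB.instance Definition _ :=
  GRing.isZmodMorphism.Build A quot_alg quot_pi quot_pi_zmod_morphism.

Definition quot_one : quot_alg := quot_pi 1.
Definition quot_mul (p q : quot_alg) : quot_alg := quot_pi (repr p * repr q).
Definition quot_scale (c : R) (q : quot_alg) : quot_alg := quot_pi (c *: repr q).

Lemma quot_piM a b : quot_pi (a * b) = quot_mul (quot_pi a) (quot_pi b).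
Proof.
have /quot_piP Ia := quot_reprK (quot_pi a).
have /quot_piP Ib := quot_reprK (quot_pi b).
apply/esym/quot_piP.
rewrite -[_ * _ as X in X - _](subrK (a * repr (quot_pi b))).
by rewrite -mulrBl -addrA -mulrBr; apply: Ideal_add;
  [exact: Ideal_mulr | exact: Ideal_mull].
Qed.

Lemma quot_piZ c a : quot_pi (c *: a) = quot_scale c (quot_pi a).
Proof.
have /quot_piP Ia := quot_reprK (quot_pi a).
apply/esym/quot_piP; rewrite -scalerBr -mulr_algl.
exact: Ideal_mull.
Qed.

Lemma quot_mulA : associative quot_mul.
Proof.
move=> p q r; rewrite -(quot_reprK p) -(quot_reprK q) -(quot_reprK r).
by rewrite -!quot_piM mulrA.
Qed.

Lemma quot_mul1 : left_id quot_one quot_mul.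
Proof. by move=> p; rewrite -(quot_reprK p) -quot_piM mul1r. Qed.

Lemma quot_mulr1 : right_id quot_one quot_mul.
Proof. by move=> p; rewrite -(quot_reprK p) -quot_piM mulr1. Qed.

Lemma quot_mulDl : left_distributive quot_mul +%R.
Proof.
move=> p q r; rewrite -(quot_reprK p) -(quot_reprK q) -(quot_reprK r).
by rewrite -raddfD -!quot_piM mulrDl raddfD.
Qed.

Lemma quot_mulDr : right_distributive quot_mul +%R.
Proof.
move=> p q r; rewrite -(quot_reprK p) -(quot_reprK q) -(quot_reprK r).
by rewrite -raddfD -!quot_piM mulrDr raddfD.
Qed.

HB.instance Definition _ := GRing.Zmodule_isPzRing.Build quot_alg
  quot_mulA quot_mul1 quot_mulr1 quot_mulDl quot_mulDr.

Lemma quot_scaleA c d p : quot_scale c (quot_scale d p) = quot_scale (c * d) p.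
Proof. by rewrite -(quot_reprK p) -!quot_piZ scalerA. Qed.

Lemma quot_scale1 : left_id 1 quot_scale.
Proof. by move=> p; rewrite -(quot_reprK p) -quot_piZ scale1r. Qed.

Lemma quot_scaleDr : right_distributive quot_scale +%R.
Proof.
move=> c p q; rewrite -(quot_reprK p) -(quot_reprK q).
by rewrite -raddfD -!quot_piZ scalerDr raddfD.
Qed.

Lemma quot_scaleDl p : {morph quot_scale^~ p : c d / c + d}.
Proof.
by move=> c d; rewrite -(quot_reprK p) -!quot_piZ scalerDl raddfD.
Qed.

HB.instance Definition _ := GRing.Zmodule_isLmodule.Build R quot_alg
  quot_scaleA quot_scale1 quot_scaleDr quot_scaleDl.

Lemma quot_pi_monoid_morphism : monoid_morphism quot_pi.
Proof. by split=> // a b; exact: quot_piM. Qed.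

HB.instance Definition _ :=
  GRing.isMonoidMorphism.Build A quot_alg quot_pi quot_pi_monoid_morphism.

Lemma quot_pi_scalable : scalable quot_pi.
Proof. exact: quot_piZ. Qed.

HB.instance Definition _ :=
  GRing.isScalable.Build R A quot_alg *:%R quot_pi quot_pi_scalable.

End Quotient.

(* Via X |-> x, Y |-> y, the algebra A has presentation < X, Y | r = 0, r in S >:
   there is an R-algebra isomorphism from the quotient of R<X, Y> by the
   two-sided ideal generated by S onto A, mapping the class of X to x and the
   class of Y to y. *)
Definition has_presentation (R : comNzRingType) (A : algType R) (x y : A)
    (S : freealg R -> Prop) : Prop :=
  exists phi : {rmorphism quot_alg S -> A},
    [/\ scalable phi, bijective phi,
        phi (quot_pi S (fX R)) = x & phi (quot_pi S (fY R)) = y].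

(* With 0-based indices: column j is e_(j+1) for j < n - 1, and the last column
   is (- f_0, ..., - f_(n-1)). This is the transpose of mxpoly.companionmx. *)
Definition companion (R : comNzRingType) (n : nat) (f : {poly R}) : 'M[R]_n :=
  \matrix_(i < n, j < n)
    if j.+1 == n then - f`_i else (i == j.+1 :> nat)%:R.

Section ExplicitPolynomials.
Variables (R : comNzRingType) (m : nat) (f g : {poly R}).

(* The size of the matrices is n = m + 1. The index j is 1-based, so that the
   (n, j)-entry has row ord_max and column j - 1. *)
Definition expl_a (j : nat) : R :=
  horner_mx (companion m.+1 g) (g - f) ord_max (inord j.-1).

Definition expl_p (j : nat) : {poly R} :=
  'X^j - \sum_(1 <= i < j.+1) (expl_a i)%:P * 'X^(j - i).

Definition expl_P (j : nat) : freealg R :=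
  horner_alg (fX R) (expl_p j) * (fX R - fY R) + fY R ^+ j.+1.

End ExplicitPolynomials.

(* The relators f(X), g(Y) and Q_j, for j = 1, ..., n - 1. A relation u = v is
   encoded by the relator u - v. *)
Inductive relators (R : comNzRingType) (n : nat) (f g : {poly R})
    (Q : nat -> freealg R) : freealg R -> Prop :=
| Rel_f : relators n f g Q (horner_alg (fX R) f)
| Rel_g : relators n f g Q (horner_alg (fY R) g)
| Rel_Q j of (0 < j < n)%N : relators n f g Q (Q j).

(* Main.v *)
(* Modulo f(X) and g(Y), every X^i Y^j reduces to exponents below n, and the
   relations for Y^j X make the span of these n^2 monomials stable under right
   multiplication by X and Y; so they span the presented algebra. The map to
   M_n(R) is onto: C - D = s e_n^T, where s holds the coefficients of g - f and
   is also the first column of g(C), hence q(C) (C - D) r(D) runs through all the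
   matrix units when g(C) is invertible, that is, when g is a unit modulo f. The
   n^2 images then generate the free module M_n(R) of rank n^2, so they form a
   basis and the map is injective. *)
From HB Require Import structures.
Require Import Defs.
From mathcomp Require Import all_boot all_order all_algebra.
From mathcomp Require boolp.
From mathcomp.multinomials Require Import monalg.

Set Implicit Arguments.
Unset Strict Implicit.
Unset Printing Implicit Defensive.

Import GRing.Theory.

Local Open Scope ring_scope.

(** Every element is a linear combination of words, and a word is built by appending letters on its
    right. This form of induction suits [normal_all], where normal forms are multiplied on the right
    by [X] and [Y]. *)
Lemma freealg_rect_r (R : comNzRingType) (P : freealg R -> Prop) :
    P 1 -> (forall a b, P a -> P b -> P (a + b)) ->
    (forall c a, P a -> P (c *: a)) ->
    (forall a, P a -> P (a * fX R)) -> (forall a, P a -> P (a * fY R)) ->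
  forall a, P a.
Proof.
move=> P1 PD PZ PX PY a.
have P0 : P 0 by rewrite -(scale0r (1 : freealg R)); apply: PZ.
have PU (k : {fmonom 'I_2}) : P (<< k >> : freealg R)%R.
  case: k; elim/last_ind => [|s i IHs].
    suff -> : FMonom [::] = @mone {fmonom 'I_2} by exact: P1.
    by apply/eqP; rewrite fmP fm1.
  have -> : FMonom (rcons s i) = mmul (FMonom s) (fmu i).
    by apply/eqP; rewrite fmP fmM fmU cats1.
  have -> : (<< mmul (FMonom s) (fmu i) >> : freealg R)%R
     = (<< FMonom s >>%R : freealg R) * fgen R i.
    by rewrite /fgen [RHS]fgmulUU mulr1.
  have [->|->] : i = 0 \/ i = 1; [|exact: PX IHs | exact: PY IHs].
  by case: i => [[|[|k]] lt_i2] //; [left|right]; apply/val_inj.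
rewrite (monalgE a); apply: (big_ind P) => // k _.
suff -> : (<< a@_k *g k >> = a@_k *: << k >> :> {malg R[{fmonom 'I_2}]})%R.
  exact: PZ.
by apply/malgP => k'; rewrite mcoeffZ !mcoeffU mulrnAr mulr1.
Qed.

(** * Combinations of the monomials x^i y^j with exponents below [N] *)

Section StandardCombinations.
Variables (R : comNzRingType) (N : nat) (A : algType R) (x y : A).

(** Storing the coefficients in a square matrix makes [std_comb C D] a linear endomorphism of the
    matrix algebra, to which [surj_mx_inj] applies. *)
Definition std_comb (c : 'M[R]_N) : A :=
  \sum_i \sum_j c i j *: (x ^+ i * y ^+ j).

Lemma std_comb_linear : linear std_comb.
Proof.
move=> a c d; rewrite /std_comb scaler_sumr -big_split; apply: eq_bigr => i _.
rewrite scaler_sumr -big_split; apply: eq_bigr => j _ /=.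
by rewrite !mxE scalerDl scalerA.
Qed.

HB.instance Definition _ :=
  GRing.isLinear.Build R 'M[R]_N A *:%R std_comb std_comb_linear.

Lemma horner_alg_sum (z : A) (p : {poly R}) (n : nat) : (size p <= n)%N ->
  horner_alg z p = \sum_(i < n) p`_i *: z ^+ i.
Proof.
move=> le_pn; rewrite /horner_alg /horner_morph (@horner_coef_wide _ n).
  by apply: eq_bigr => i _; rewrite coef_map mulr_algl.
exact: leq_trans (size_poly _ _) le_pn.
Qed.

Lemma std_comb_poly (p q : {poly R}) : (size p <= N)%N -> (size q <= N)%N ->
  std_comb (\matrix_(i, j) (p`_i * q`_j)) = horner_alg x p * horner_alg y q.
Proof.
move=> le_p le_q; rewrite (horner_alg_sum _ le_p) (horner_alg_sum _ le_q).
rewrite mulr_suml; apply: eq_bigr => i _; rewrite mulr_sumr.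
by apply: eq_bigr => j _; rewrite mxE -scalerAl -scalerAr scalerA.
Qed.

End StandardCombinations.

(** * Evaluation of polynomials, standard combinations and ideals *)

Section Evaluation.
Variables (R : comNzRingType) (A : algType R) (x y : A).

Lemma feval_hornerX (p : {poly R}) :
  feval x y (horner_alg (fX R) p) = horner_alg x p.
Proof.
rewrite !(horner_alg_sum _ (leqnn _)) linear_sum; apply: eq_bigr => i _.
by rewrite linearZ rmorphXn /= fevalX.
Qed.

Lemma feval_hornerY (p : {poly R}) :
  feval x y (horner_alg (fY R) p) = horner_alg y p.
Proof.
rewrite !(horner_alg_sum _ (leqnn _)) linear_sum; apply: eq_bigr => i _.
by rewrite linearZ rmorphXn /= fevalY.
Qed.

Lemma feval_std_comb (N : nat) (c : 'M[R]_N) :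
  feval x y (std_comb (fX R) (fY R) c) = std_comb x y c.
Proof.
rewrite linear_sum; apply: eq_bigr => i _; rewrite linear_sum.
by apply: eq_bigr => j _; rewrite linearZ rmorphM !rmorphXn /= fevalX fevalY.
Qed.

Lemma feval_ideal (S : freealg R -> Prop) :
  (forall r, S r -> feval x y r = 0) ->
  forall a, ideal_gen S a -> feval x y a = 0.
Proof.
move=> S0 a; elim=> {a} [a /S0|| a b _ Ia _ Ib|a b _ Ib|a b _ Ia] //.
- by rewrite raddf0.
- by rewrite raddfD /= Ia Ib addr0.
- by rewrite rmorphM /= Ib mulr0.
- by rewrite rmorphM /= Ia mul0r.
Qed.

End Evaluation.

(** * Reduction to normal form in the presented algebra *)

Section NormalForms.
Variables (R : comNzRingType) (N : nat) (S : freealg R -> Prop).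
Local Notation X := (fX R).
Local Notation Y := (fY R).
Local Notation pi := (quot_pi S).

(** Only existence is asked of a normal form; uniqueness will come from the images in the matrix
    algebra. *)
Definition normal (a : freealg R) : Prop :=
  exists c : 'M[R]_N, pi a = pi (std_comb X Y c).

Lemma normal_eq (a b : freealg R) : pi a = pi b -> normal b -> normal a.
Proof. by move=> ab [c bc]; exists c; rewrite ab. Qed.

Lemma normalD (a b : freealg R) : normal a -> normal b -> normal (a + b).
Proof.
move=> [c ac] [d bd]; exists (c + d).
by rewrite (linearD (std_comb X Y)) !raddfD /= ac bd.
Qed.

Lemma normalZ (k : R) (a : freealg R) : normal a -> normal (k *: a).
Proof.
move=> [c ac]; exists (k *: c); rewrite (linearZ_LR (std_comb X Y)).
exact: etrans (quot_piZ _ _ _) (etrans (congr1 _ ac) (esym (quot_piZ _ _ _))).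
Qed.

Lemma normal0 : normal 0.
Proof. by exists 0; rewrite (linear0 (std_comb X Y)). Qed.

Lemma normal_sum (I : Type) (r : seq I) (F : I -> freealg R) :
  (forall i, normal (F i)) -> normal (\sum_(i <- r) F i).
Proof.
by move=> nF; apply: (big_ind normal) => //; [exact: normal0 | exact: normalD].
Qed.

Lemma quot_pi_mul (a b a' b' : freealg R) :
  pi a = pi a' -> pi b = pi b' -> pi (a * b) = pi (a' * b').
Proof.
move=> aa' bb'; apply: etrans (quot_piM _ _ _) _.
rewrite aa' bb'; exact (esym (quot_piM S a' b')).
Qed.

(** Division with remainder by a monic polynomial works over any commutative ring, and the multiple
    of h(z) that it splits off lies in the ideal. *)
Lemma quot_pi_rmodp (z : freealg R) (h p : {poly R}) : h \is monic ->
    S (horner_alg z h) ->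
  pi (horner_alg z p) = pi (horner_alg z (Pdiv.Ring.rmodp p h)).
Proof.
move=> h_monic Sh; apply/quot_piP; rewrite -rmorphB.
rewrite {1}(Pdiv.RingMonic.rdivp_eq h_monic p) addrK rmorphM.
exact/Ideal_mull/Ideal_gen.
Qed.

Variables (f g : {poly R}).
Hypotheses (f_monic : f \is monic) (g_monic : g \is monic).
Hypotheses (size_f : size f = N.+1) (size_g : size g = N.+1).
Hypotheses (Sf : S (horner_alg X f)) (Sg : S (horner_alg Y g)).

Lemma normal_poly (p q : {poly R}) : normal (horner_alg X p * horner_alg Y q).
Proof.
pose r := Pdiv.Ring.rmodp p f; pose s := Pdiv.Ring.rmodp q g.
have le_r : (size r <= N)%N.
  by rewrite -ltnS -size_f Pdiv.Ring.ltn_rmodpN0 // monic_neq0.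
have le_s : (size s <= N)%N.
  by rewrite -ltnS -size_g Pdiv.Ring.ltn_rmodpN0 // monic_neq0.
exists (\matrix_(i, j) (r`_i * s`_j)); rewrite (std_comb_poly _ _ le_r le_s).
exact (quot_pi_mul (quot_pi_rmodp p f_monic Sf) (quot_pi_rmodp q g_monic Sg)).
Qed.

Lemma normal_monomial (i j : nat) : normal (X ^+ i * Y ^+ j).
Proof.
by have := normal_poly 'X^i 'X^j; rewrite !rmorphXn /= !horner_algX.
Qed.

Lemma normal_in_XY (p : freealg R) : in_XY p -> normal p.
Proof.
move=> [d [c ->]]; do 2![apply: normal_sum => ?].
exact/normalZ/normal_monomial.
Qed.

Lemma normal_mulXn (i : nat) (a : freealg R) : normal a -> normal (X ^+ i * a).
Proof.
move=> [c ac]; apply: (@normal_eq _ (X ^+ i * std_comb X Y c)).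
  exact: quot_pi_mul.
rewrite mulr_sumr; apply: normal_sum => k; rewrite mulr_sumr.
apply: normal_sum => j; rewrite -scalerAr mulrA -exprD.
exact/normalZ/normal_monomial.
Qed.

Hypothesis normal_YX : forall j, (0 < j < N)%N -> normal (Y ^+ j * X).

(** Appending [Y] to X^i Y^j only raises the exponent of [Y], which [g] reduces. Appending [X]
    creates Y^j X, normal by [normal_YX], and the factor X^i on the left is absorbed by
    [normal_mulXn]. *)
Lemma normal_all (a : freealg R) : normal a.
Proof.
elim/freealg_rect_r: a => [|a b|k a|a [c ac]|a [c ac]].
- by have := normal_monomial 0 0; rewrite mulr1.
- exact: normalD.
- exact: normalZ.
- apply: (@normal_eq _ (std_comb X Y c * X)); first exact: quot_pi_mul.
  rewrite mulr_suml; apply: normal_sum => i; rewrite mulr_suml.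
  apply: normal_sum => j; rewrite -scalerAl -mulrA; apply: normalZ.
  apply: normal_mulXn; have [->|j_gt0] := posnP j.
    (* For j = 0 no relation is involved: the factor is [X] itself. *)
    by rewrite mul1r; have := normal_monomial 1 0; rewrite mulr1.
  by apply: normal_YX; rewrite j_gt0 ltn_ord.
- apply: (@normal_eq _ (std_comb X Y c * Y)); first exact: quot_pi_mul.
  rewrite mulr_suml; apply: normal_sum => i; rewrite mulr_suml.
  apply: normal_sum => j; rewrite -scalerAl -mulrA -exprSr.
  exact/normalZ/normal_monomial.
Qed.

End NormalForms.

(** * The map induced by evaluation on the quotient *)

Section Presentation.
Variables (R : comNzRingType) (A : algType R) (x y : A).
Variable S : freealg R -> Prop.
Hypothesis S0 : forall r, S r -> feval x y r = 0.

(** The choice of representative is harmless: evaluation kills the ideal, as [quot_eval_pi] makes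
    precise. *)
Definition quot_eval (q : quot_alg S) : A := feval x y (repr q).

Lemma quot_eval_pi (a : freealg R) : quot_eval (quot_pi S a) = feval x y a.
Proof.
apply/eqP; rewrite -subr_eq0 -raddfB; apply/eqP; apply: (feval_ideal S0).
exact/quot_piP/quot_reprK.
Qed.

Lemma quot_eval_zmod_morphism : zmod_morphism quot_eval.
Proof.
move=> p q; rewrite -(quot_reprK p) -(quot_reprK q) -raddfB.
by rewrite !quot_eval_pi raddfB.
Qed.

Lemma quot_eval_monoid_morphism : monoid_morphism quot_eval.
Proof.
split=> [|p q]; first by rewrite [LHS]quot_eval_pi rmorph1.
rewrite -(quot_reprK p) -(quot_reprK q) -[_ * _](quot_piM S).
by rewrite !quot_eval_pi rmorphM.
Qed.

HB.instance Definition _ :=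
  GRing.isZmodMorphism.Build (quot_alg S) A quot_eval quot_eval_zmod_morphism.
HB.instance Definition _ :=
  GRing.isMonoidMorphism.Build (quot_alg S) A quot_eval
    quot_eval_monoid_morphism.

Lemma has_presentation_of_bij :
    (forall b, exists a, feval x y a = b) ->
    (forall a, feval x y a = 0 -> quot_pi S a = 0) ->
  has_presentation x y S.
Proof.
move=> surj inj; exists quot_eval; split.
- move=> k q /=; rewrite -(quot_reprK q).
  have <- : quot_pi S (k *: repr q) = k *: quot_pi S (repr q) := quot_piZ S _ _.
  by rewrite !quot_eval_pi linearZ.
- have [h hK] := boolp.choice surj.
  exists (fun b => quot_pi S (h b)) => [q|b] /=.
    rewrite -(quot_reprK q) quot_eval_pi; apply/eqP; rewrite -subr_eq0 -raddfB.
    by apply/eqP/inj; rewrite raddfB /= hK subrr.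
  by rewrite quot_eval_pi.
- by rewrite [LHS]quot_eval_pi fevalX.
- by rewrite [LHS]quot_eval_pi fevalY.
Qed.

End Presentation.

(** Preimages of the basis vectors form the rows of a left inverse of the square matrix of [F]. Over
    a commutative ring a one-sided inverse of a square matrix is two-sided, which yields
    injectivity. *)
Lemma surj_mx_inj (R : comNzRingType) (p q : nat)
    (F : {linear 'M[R]_(p, q) -> 'M[R]_(p, q)}) :
  (forall B, exists c, F c = B) -> injective F.
Proof.
move=> surj; apply: raddf_inj => c Fc0.
have exV (i : 'I_(p * q)) :
    exists v : 'rV_(p * q), v *m lin_mx F = delta_mx 0 i.
  have [d Fd] := surj (vec_mx (delta_mx 0 i)).
  by exists (mxvec d); rewrite mul_vec_lin Fd vec_mxK.
have [h hK] := boolp.choice exV.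
have VF1 : (\matrix_i h i) *m lin_mx F = 1%:M.
  by apply/row_matrixP => i; rewrite row_mul rowK row1 hK.
have FV1 := mulmx1C VF1.
rewrite -(mxvecK c) -[mxvec c]mulmx1 -FV1 mulmxA mul_vec_lin Fc0.
by rewrite linear0 mul0mx linear0.
Qed.

(** * A criterion for presenting the matrix algebra *)

Section MatrixPresentation.
Variables (R : comNzRingType) (m : nat) (C D : 'M[R]_m.+1).
Variables (S : freealg R -> Prop).
Hypothesis S0 : forall r, S r -> feval C D r = 0.
Hypothesis surj : forall B, exists a, feval C D a = B.
Hypothesis normalS : forall a, normal m.+1 S a.

(** [std_comb C D] is onto, because evaluation is onto and every element has a normal form. It is
    therefore injective, so a normal form of an element of the kernel has zero coefficients. *)
Lemma has_presentation_of_normal : has_presentation C D S.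
Proof.
have fevalE (a : freealg R) (c : 'M_m.+1) :
    quot_pi S a = quot_pi S (std_comb (fX R) (fY R) c) ->
  feval C D a = std_comb C D c.
  move=> /quot_piP /(feval_ideal S0) /eqP.
  by rewrite raddfB subr_eq0 /= feval_std_comb => /eqP.
apply: (has_presentation_of_bij S0 surj) => a a0; have [c ac] := normalS a.
rewrite ac; suff -> : c = 0 by rewrite (linear0 (std_comb _ _)) raddf0.
apply: (@surj_mx_inj _ _ _ (std_comb C D)); last first.
  by rewrite /= -(fevalE _ _ ac) a0 (linear0 (std_comb C D)).
move=> B; have [b <-] := surj B; have [d bd] := normalS b.
by exists d; rewrite (fevalE _ _ bd).
Qed.

End MatrixPresentation.

Lemma horner_alg_mx (R : comNzRingType) (m : nat) (A : 'M[R]_m.+1)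
    (p : {poly R}) :
  horner_alg A p = horner_mx A p.
Proof.
rewrite /horner_alg /horner_mx /horner_morph; congr (_.[A]).
by apply: eq_map_poly => k; rewrite /= scalemx1.
Qed.

(** * Companion matrices acting on the canonical basis, indexed from 0 *)

Section Companion.
Variables (R : comNzRingType) (m : nat).
Implicit Types (f g p : {poly R}).
Local Notation comp f := (companion m.+1 f : 'M[R]_m.+1).
Local Notation e k := (delta_mx (inord k) 0 : 'cV[R]_m.+1).
Local Notation coefs p := (\col_(i < m.+1) p`_i : 'cV[R]_m.+1).
Local Notation last_row := (delta_mx 0 ord_max : 'rV[R]_m.+1).

Lemma companion_mul_e f (k : nat) : (k < m)%N -> comp f *m e k = e k.+1.
Proof.
move=> lt_km; rewrite -colE; apply/colP => i; rewrite !mxE eqxx andbT.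
rewrite -val_eqE /= !inordK // ?ltnS //; last exact: ltnW.
by rewrite eqSS (ltn_eqF lt_km).
Qed.

Lemma companion_mul_e_max f : comp f *m e m = - coefs f.
Proof.
by rewrite -colE; apply/colP => i; rewrite !mxE inordK // eqxx.
Qed.

Lemma companion_exp_e f (k : nat) : (k <= m)%N -> comp f ^+ k *m e 0 = e k.
Proof.
elim: k => [|k IHk] lt_km; first by rewrite expr0 mul1mx.
by rewrite exprS -mulmxA IHk ?companion_mul_e // ltnW.
Qed.

Lemma horner_companion_e0 f p : (size p <= m.+1)%N ->
  horner_mx (comp f) p *m e 0 = coefs p.
Proof.
move=> le_p; rewrite -horner_alg_mx (horner_alg_sum _ le_p) mulmx_suml.
apply/colP => i; rewrite summxE (bigD1 i) //= big1 => [|j neq_ji].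
  rewrite -scalemxAl companion_exp_e ?leq_ord // !mxE inord_val !eqxx.
  by rewrite mulr1 addr0.
rewrite -scalemxAl companion_exp_e ?leq_ord // !mxE inord_val eqxx andbT.
by rewrite eq_sym (negbTE neq_ji) mulr0.
Qed.

(** The vector C^(m+1) e_0 = C e_m cancels the lower terms of f(C) e_0. Since f(C) commutes with C
    and e_i = C^i e_0, it kills every basis vector. *)
Lemma horner_companion f : f \is monic -> size f = m.+2 ->
  horner_mx (comp f) f = 0.
Proof.
move=> f_monic size_f.
have f_e0 : horner_mx (comp f) f *m e 0 = 0.
  have f_def : f = 'X^(m.+1) + (f - 'X^(m.+1)) by rewrite addrC subrK.
  have le_f : (size (f - 'X^(m.+1))%R <= m.+1)%N.
    apply/leq_sizeP => j; rewrite leq_eqVlt => /predU1P[<-|lt_mj].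
      rewrite coefB coefXn eqxx; have := monicP f_monic.
      by rewrite lead_coefE size_f => ->; rewrite subrr.
    by rewrite coefB coefXn gtn_eqF // subr0 nth_default // size_f.
  rewrite {2}f_def rmorphD rmorphXn /= horner_mx_X mulmxDl.
  rewrite horner_companion_e0 //.
  rewrite exprS -mulmxA companion_exp_e // companion_mul_e_max.
  apply/colP => i; rewrite !mxE coefB coefXn ltn_eqF ?ltn_ord //.
  by rewrite subr0 addNr.
suff col_f0 i : col i (horner_mx (comp f) f) = 0.
  by apply/matrixP => k i; have /colP/(_ k) := col_f0 i; rewrite !mxE.
rewrite colE -{1}(inord_val i).
rewrite -(companion_exp_e f (leq_ord i)) mulmxA.
have comm_f : GRing.comm (horner_mx (comp f) f) (comp f).
  by apply: comm_horner_mx.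
by rewrite [_ *m _ ^+ i](commrX i comm_f) -mulmxA f_e0 mulmx0.
Qed.

(** The two matrices differ only in their last column. *)
Lemma companion_sub f g : comp f - comp g = coefs (g - f) *m last_row.
Proof.
apply/matrixP => i j; rewrite !mxE big_ord1 !mxE eqxx coefB.
have -> : (j.+1 == m.+1)%N = (j == ord_max) by rewrite eqSS.
by case: (j == ord_max); rewrite ?mulr1 ?mulr0 ?subrr // opprK addrC.
Qed.

(** The last row is cyclic for right multiplication by D; the basis rows are reached downwards from
    the last one. *)
Lemma companion_last_row g (j : 'I_m.+1) :
  exists r : {poly R}, last_row *m horner_mx (comp g) r = delta_mx 0 j.
Proof.
suff H k : (k <= m)%N -> exists r : {poly R},
    last_row *m horner_mx (comp g) r = delta_mx 0 (inord (m - k)).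
  have [|r Hr] := H (m - j)%N; first exact: leq_subr.
  by exists r; rewrite Hr subKn ?leq_ord // inord_val.
elim: k => [_|k IHk lt_km].
  exists 1; rewrite rmorph1 mulmx1; congr (delta_mx _ _).
  by apply/val_inj; rewrite /= subn0 inordK.
have [r Hr] := IHk (ltnW lt_km); pose l := (m - k.+1)%N.
have l1E : (m - k)%N = l.+1 by rewrite /l subnSK.
have lt_lm : (l < m)%N by rewrite -l1E leq_subr.
(* Row l+1 of D is e_l^T - g_(l+1) e_m^T, so multiplying e_(l+1)^T by D and adding g_(l+1) times the
   last row gives e_l^T. These are the Horner quotients of [g]. *)
exists (r * 'X + (g`_l.+1)%:P).
rewrite rmorphD rmorphM /= horner_mx_X horner_mx_C.
rewrite mulmxDr mulmxA Hr -rowE mul_mx_scalar; apply/rowP => i.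
rewrite !mxE l1E inordK ?ltnS // !eqxx eqSS -!val_eqE /=.
rewrite inordK; last exact: ltnW.
rewrite eqSS [l == _]eq_sym; case: eqP => [->|_].
  by rewrite (gtn_eqF lt_lm) mulr1 addNr.
by rewrite mulr0 addr0.
Qed.

End Companion.

(** * The pair C, D and the relations between them *)

Section CompanionPair.
Variables (R : comNzRingType) (m : nat) (f g : {poly R}).
Hypotheses (f_monic : f \is monic) (g_monic : g \is monic).
Hypotheses (size_f : size f = m.+2) (size_g : size g = m.+2).
Local Notation C := (companion m.+1 f : 'M[R]_m.+1).
Local Notation D := (companion m.+1 g : 'M[R]_m.+1).
Local Notation e k := (delta_mx (inord k) 0 : 'cV[R]_m.+1).
Local Notation s := (\col_(i < m.+1) (g - f)`_i : 'cV[R]_m.+1).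
Local Notation last_row := (delta_mx 0 ord_max : 'rV[R]_m.+1).

Lemma size_monic_sub : (size (g - f)%R <= m.+1)%N.
Proof.
apply/leq_sizeP => j; rewrite leq_eqVlt coefB => /predU1P[<-|lt_mj].
  have := monicP f_monic; have := monicP g_monic.
  by rewrite !lead_coefE size_f size_g => /= -> ->; rewrite subrr.
by rewrite !nth_default ?subrr // (size_f, size_g).
Qed.

(** As f(C) = 0, g(C) equals (g - f)(C), and g - f has degree at most [m]. *)
Lemma horner_C_e0 : horner_mx C g *m e 0 = s.
Proof.
rewrite -(horner_companion_e0 f size_monic_sub) rmorphB.
by rewrite /= (horner_companion f_monic size_f) subr0.
Qed.

Lemma feval_companion_surj (v : {poly R}) : horner_mx C (v * g) = 1 ->
  forall B, exists a, feval C D a = B.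
Proof.
move=> vg1 B; have [r Hr] := boolp.choice (@companion_last_row R m g).
have evalE (a b : freealg R) : feval C D (a * (fX R - fY R) * b)
    = feval C D a * (C - D) * feval C D b.
  by rewrite rmorphM rmorphM rmorphB /= fevalX fevalY.
(* Since s = g(C) e_0 and v(C) inverts g(C), q_i(C) s = C^i e_0 = e_i. With e_n^T r_j(D) = e_j^T,
   the product q_i(C) (C - D) r_j(D) is the matrix unit at (i, j). *)
pose q (i : 'I_m.+1) := 'X^i * v.
exists (\sum_i \sum_j B i j *: (horner_alg (fX R) (q i) *
  (fX R - fY R) * horner_alg (fY R) (r j))).
rewrite linear_sum [RHS]matrix_sum_delta; apply: eq_bigr => i _.
rewrite linear_sum; apply: eq_bigr => j _; rewrite linearZ; congr (_ *: _).
apply: etrans (evalE _ _) _; rewrite feval_hornerX feval_hornerY.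
rewrite !horner_alg_mx companion_sub -!mulmxE -!mulmxA Hr -horner_C_e0 !mulmxA.
have -> : horner_mx C (q i) *m horner_mx C g = C ^+ i.
  rewrite mulmxE -rmorphM -mulrA rmorphM /= vg1 mulr1.
  by rewrite rmorphXn /= horner_mx_X.
by rewrite companion_exp_e ?leq_ord // inord_val mul_delta_mx.
Qed.

(** Common source of the three presentations: [v] inverts [g] modulo [f], [P] need only have normal
    forms, and [QE] leaves the relators free to be written in another shape. *)
Lemma companion_presentation (v : {poly R}) (P Q : nat -> freealg R) :
    horner_mx C (v * g) = 1 ->
    (forall j, (0 < j < m.+1)%N -> Q j = fY R ^+ j * fX R - P j) ->
    (forall j, (0 < j < m.+1)%N ->
       normal m.+1 (relators m.+1 f g Q) (P j)) ->
    (forall j, (0 < j < m.+1)%N -> D ^+ j * C = feval C D (P j)) ->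
  has_presentation C D (relators m.+1 f g Q).
Proof.
move=> vg1 QE normP evalP; apply: has_presentation_of_normal.
- move=> _ [||j lt_j].
  + by rewrite feval_hornerX horner_alg_mx horner_companion.
  + by rewrite feval_hornerY horner_alg_mx horner_companion.
  + rewrite QE // rmorphB rmorphM rmorphXn /= fevalX fevalY evalP //.
    by rewrite subrr.
- exact: feval_companion_surj vg1.
- apply: (normal_all f_monic g_monic size_f size_g); try exact: Rel_f.
    exact: Rel_g.
  move=> j lt_j; apply: normal_eq (normP j lt_j).
  by apply/quot_piP; rewrite -QE //; exact/Ideal_gen/Rel_Q.
Qed.

Lemma expl_pS (j : nat) :
  expl_p m f g j.+1 = expl_p m f g j * 'X - (expl_a m f g j.+1)%:P.
Proof.
rewrite /expl_p big_nat_recr //= subnn expr0 mulr1 opprD addrA; congr (_ - _).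
rewrite mulrBl -exprSr mulr_suml; congr (_ - _).
rewrite !big_nat; apply: eq_bigr => i /andP[_ lt_ij].
by rewrite -mulrA -exprSr subSn.
Qed.

(* D = C - s e_n^T and e_n^T D^j s is the (n, j+1)-entry of s(D), so passing from
   D^j s to D^(j+1) s multiplies p_j by X and subtracts a_(j+1). *)
Lemma companion_exp_s (j : nat) : (j <= m)%N ->
  D ^+ j *m s = horner_mx C (expl_p m f g j) *m s.
Proof.
elim: j => [_|j IHj lt_jm].
  by rewrite /expl_p big_geq // subr0 expr0 rmorph1.
(* Here s = s(D) e_0, and s(D) commutes with D^j, so D^j s = s(D) e_j. *)
have a_j : last_row *m (D ^+ j *m s) = (expl_a m f g j.+1)%:M.
  have comm_s : GRing.comm (horner_mx D (g - f)) D by apply: comm_horner_mx.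
  rewrite -(horner_companion_e0 g size_monic_sub) [D ^+ j *m _]mulmxA.
  rewrite -[D ^+ j *m _](commrX j comm_s) -[_ * _ *m _]mulmxA.
  rewrite companion_exp_e 1?ltnW // -colE -rowE.
  by apply/matrixP => a b; rewrite !mxE !ord1 mulr1n.
rewrite expl_pS rmorphB /= horner_mx_C mulmxBl mul_scalar_mx.
rewrite exprS -mulmxA {1}IHj ?(ltnW lt_jm) //.
rewrite -[D in LHS](subKr C) companion_sub mulmxBl.
rewrite -[s *m _ *m _]mulmxA -IHj ?(ltnW lt_jm) // a_j mul_mx_scalar.
congr (_ - _).
by rewrite IHj ?(ltnW lt_jm) // mulmxA mulrC rmorphM /= horner_mx_X.
Qed.

(** Write D^j C = D^j (C - D) + D^(j+1), where C - D = s e_n^T, and replace D^j s by p_j(C) s. *)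
Lemma feval_expl_P (j : nat) : (0 < j < m.+1)%N ->
  D ^+ j * C = feval C D (expl_P m f g j).
Proof.
move=> /andP[_ lt_j]; have := companion_exp_s lt_j; rewrite /expl_P.
move: (expl_p m f g j) => p pE.
rewrite rmorphD rmorphM rmorphB rmorphXn /= fevalX fevalY feval_hornerX.
rewrite horner_alg_mx exprSr -[X in _ * X = _](subrK D) mulrDr.
by rewrite companion_sub [X in X + _]mulmxA pE -mulmxA.
Qed.

(** In p(X) X - p(X) Y + Y^(j+1) every [X] already stands to the left of every [Y]. *)
Lemma normal_expl_P (Q : nat -> freealg R) (j : nat) :
  normal m.+1 (relators m.+1 f g Q) (expl_P m f g j).
Proof.
have nXY := normal_poly f_monic g_monic size_f size_g
  (Rel_f m.+1 f g Q) (Rel_g m.+1 f g Q).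
rewrite /expl_P; move: (expl_p m f g j) => p; rewrite mulrBr.
apply: normalD; first apply: normalD.
- have := nXY (p * 'X) 1.
  by rewrite rmorphM rmorph1 /= horner_algX mulr1.
- rewrite -scaleN1r; apply: normalZ.
  by have := nXY p 'X; rewrite /= horner_algX.
- by have := nXY 1 'X^(j.+1); rewrite rmorph1 rmorphXn /= horner_algX mul1r.
Qed.

(** Now s = u e_0, and both C^j and D^j send e_0 to e_j for j at most [m]; hence D^j (C - D) = C^j
    (C - D). *)
Lemma feval_constant (u : R) (j : nat) : g - f = u%:P -> (j <= m)%N ->
  D ^+ j * C = feval C D
    (fX R ^+ j.+1 + fY R ^+ j.+1 - fX R ^+ j * fY R).
Proof.
move=> gfE le_jm.
have evalE (a b c d : freealg R) : feval C D (a + b - c * d)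
    = feval C D a + feval C D b - feval C D c * feval C D d.
  by rewrite rmorphB rmorphD rmorphM.
have evalXn k : feval C D (fX R ^+ k) = C ^+ k by rewrite rmorphXn /= fevalX.
have evalYn k : feval C D (fY R ^+ k) = D ^+ k by rewrite rmorphXn /= fevalY.
apply: etrans _ (esym (evalE _ _ _ _)).
rewrite (congr2 +%R (evalXn j.+1) (evalYn j.+1)).
rewrite (congr2 *%R (evalXn j) (fevalY C D)).
have sE : s = u *: e 0.
  rewrite gfE; apply/colP => i; rewrite !mxE eqxx andbT coefC -val_eqE /=.
  rewrite inordK //.
  by case: eqP => _; rewrite ?mulr1 ?mulr0.
have : D ^+ j * (C - D) = C ^+ j * (C - D).
  rewrite companion_sub sE [LHS]mulmxA [RHS]mulmxA -!scalemxAr.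
  by rewrite !companion_exp_e.
rewrite !mulrBr -!exprSr => /eqP; rewrite subr_eq => /eqP ->.
by rewrite addrAC.
Qed.

End CompanionPair.

(* The size of the matrices, at least 2, is written n.+2. *)
Theorem theorem8p1 (R : comUnitRingType) (n : nat) (f g : {poly R})
    (f_monic : f \is monic) (g_monic : g \is monic)
    (size_f : size f = n.+3) (size_g : size g = n.+3) :
  let C : 'M[R]_n.+2 := companion n.+2 f in
  let D : 'M[R]_n.+2 := companion n.+2 g in
  let X := fX R in
  let Y := fY R in
  [/\ resultant f g \is a GRing.unit ->
        has_presentation C D
          (relators n.+2 f g (fun j => Y ^+ j * X - expl_P n.+1 f g j)),
      resultant f g \is a GRing.unit ->
        forall P : nat -> freealg R,
          (forall j, (0 < j < n.+2)%N -> in_XY (P j)) ->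
          (forall j, (0 < j < n.+2)%N -> D ^+ j * C = feval C D (P j)) ->
        has_presentation C D
          (relators n.+2 f g (fun j => Y ^+ j * X - P j))
    & (exists2 u : R, u \is a GRing.unit & g - f = u%:P) ->
        has_presentation C D
          (relators n.+2 f g (fun j =>
             (Y ^+ j * X + X ^+ j * Y) - (X ^+ j.+1 + Y ^+ j.+1)))].
Proof.
move=> C D X Y.
have Cf0 : horner_mx C f = 0 := horner_companion f_monic size_f.
have pres := companion_presentation f_monic g_monic size_f size_g.
(* Evaluating a Bezout identity k = w f + v g at C removes the term in [f], so v / k inverts [g]
   modulo [f]. *)
have invg (v : {poly R}) (k : R) : k \is a GRing.unit ->
    (exists w, k%:P = w * f + v * g) -> horner_mx C (k^-1 *: v * g) = 1.
  move=> k_unit [w kE]; rewrite -scalerAl linearZ /=.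
  have -> : horner_mx C (v * g) = horner_mx C k%:P.
    by rewrite kE rmorphD [X in X + _]rmorphM /= Cf0 mulr0 add0r.
  by rewrite horner_mx_C scale_scalar_mx mulVr.
have nXY Q (i k : nat) :
    normal n.+2 (relators n.+2 f g Q) (X ^+ i * Y ^+ k).
  exact: (normal_monomial f_monic g_monic size_f size_g
    (Rel_f n.+2 f g Q) (Rel_g n.+2 f g Q)).
have normXY Q p : in_XY p -> normal n.+2 (relators n.+2 f g Q) p.
  exact: (normal_in_XY f_monic g_monic size_f size_g
    (Rel_f n.+2 f g Q) (Rel_g n.+2 f g Q)).
(* The resultant lies in the ideal generated by [f] and [g], which supplies the Bezout identity. *)
have resP : resultant f g \is a GRing.unit ->
    exists v, horner_mx C (v * g) = 1.
  move=> res_unit; have [||[w v] /= _ kE] := @resultant_in_ideal _ f g.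
  - by rewrite size_f.
  - by rewrite size_g.
  - by exists ((resultant f g)^-1 *: v); apply: invg => //; exists w.
split=> [/resP[v vg1]|/resP[v vg1] P XY_P evalP|[u u_unit gfE]].
- apply: (pres v (expl_P n.+1 f g)) => // j lt_j; first exact: normal_expl_P.
  exact: feval_expl_P.
- by apply: (pres v P) => // j lt_j; apply: normXY; apply: XY_P.
(* The Bezout identity is now u = (-1) f + 1 g. *)
- apply: (pres (u^-1 *: 1) (fun j => X ^+ j.+1 + Y ^+ j.+1 - X ^+ j * Y)).
  + by apply: invg => //; exists (-1); rewrite mulN1r mul1r addrC gfE.
  + by move=> j _; rewrite opprB addrA addrAC.
  + move=> j _; apply: normalD; first apply: normalD.
    * by rewrite -[X ^+ _]mulr1; apply: nXY j.+1 0%N.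
    * by rewrite -[Y ^+ _]mul1r; apply: nXY 0%N j.+1.
    * by rewrite -scaleN1r; apply: normalZ; apply: nXY j 1%N.
  + by move=> j /andP[_ lt_j]; apply: feval_constant gfE _.
Qed.
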